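(* Let $N\ge 3$ and let $a_1,a_2\in\mathbb{C}$ with $|a_1|^2+|a_2|^2=1$. For the $N$-qubit generalized GHZ state $$|GHZ_N\rangle_g=a_1|0\rangle^{\otimes N}+a_2|1\rangle^{\otimes N}\in(\mathbb{C}^2)^{\otimes N},$$ the localizable generalized geometric measure with measurement on the first qubit equals the generalized geometric measure of the state: $$E_L^1(|GHZ_N\rangle_g)=\mathcal{G}(|GHZ_N\rangle_g).$$
   Context: Generalized geometric measure (GGM): for a unit vector $|\psi\rangle\in(\mathbb{C}^2)^{\otimes n}$, $n\ge 2$, $$\mathcal{G}(|\psi\rangle)=1-\max_{\mathcal{A}:\mathcal{B}}\lambda^2_{\mathcal{A}:\mathcal{B}},$$ where the maximum is over all bipartitions of $\{1,\dots,n\}$ into nonempty disjoint sets $\mathcal{A},\mathcal{B}$ with $\mathcal A\cup\mathcal B=\{1,\dots,n\}$, and $\lambda_{\mathcal{A}:\mathcal{B}}$ is the largest Schmidt coefficient of $|\psi\rangle$ across $\mathcal{A}:\mathcal{B}$. Localizable generalized geometric measure (LGGM) with a single measured qubit $r\in\{1,\dots,N\}$, $N\ge3$: for an orthonormal basis $\{|\xi^1\rangle,|\xi^2\rangle\}$ of the space $\mathbb{C}^2$ of qubit $r$, let $\Pi^l=|\xi^l\rangle\langle\xi^l|\otimes\mathbb{I}_{N-1}$ (acting on qubit $r$ in the first factor), $p^l=\langle\Phi|\Pi^l|\Phi\rangle$, and, if $p^l>0$, let $|\psi^l_{N-1}\rangle$ be the unit vector of the other $N-1$ qubits with $\Pi^l|\Phi\rangle/\sqrt{p^l}=|\xi^l\rangle\otimes|\psi^l_{N-1}\rangle$.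 Then $$E_L^r(|\Phi\rangle)=\sup\sum_{l=1}^2p^l\,\mathcal{G}(|\psi^l_{N-1}\rangle),$$ the supremum being over all orthonormal bases of qubit $r$ (outcomes with $p^l=0$ contribute $0$). *)

(* Defs.v *)
From HB Require Import structures.
From mathcomp Require Import all_boot all_order all_algebra.
From mathcomp Require Import complex.
From mathcomp Require Import boolp classical_sets reals.

Set Implicit Arguments.
Unset Strict Implicit.
Unset Printing Implicit Defensive.

Import Order.TTheory GRing.Theory Num.Theory.
Local Open Scope ring_scope.
Local Open Scope complex_scope.

(* Kets are coordinate vectors in a computational basis labelled by T.
   A register of qubits may be labelled by any finite type I, so that the
   qubits in a subset D of I form the register labelled by {i | i \in D}. *)
Definition ket (R : realType) (T : finType) := {ffun T -> R[i]}.

Notation qubit R := (ket R 'I_2).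
Notation register R I := (ket R {ffun I -> 'I_2}).
Notation subregister R D := (register R {i | i \in D}).

(* Antilinear in the first argument. *)
Definition braket (R : realType) (T : finType) (u v : ket R T) : R[i] :=
  \sum_t (u t)^* * v t.

Definition unit_ket (R : realType) (T : finType) (u : ket R T) : Prop :=
  braket u u = 1.

Definition orthonormal_family (R : realType) (T J : finType)
    (e : J -> ket R T) : Prop :=
  forall j k, braket (e j) (e k) = (j == k)%:R.

Definition basis_ket (R : realType) (b : 'I_2) : qubit R :=
  [ffun c => (c == b)%:R].

Definition tensor_power (R : realType) (I : finType) (phi : qubit R) :
    register R I :=
  [ffun x : {ffun I -> 'I_2} => \prod_i phi (x i)].

Definition restrict (I : finType) (D : {set I}) (x : {ffun I -> 'I_2}) :
    {ffun {i | i \in D} -> 'I_2} :=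
  [ffun i => x (val i)].

Definition tensor (R : realType) (I : finType) (A : {set I})
    (u : subregister R A) (v : subregister R (~: A)) : register R I :=
  [ffun x => u (restrict A x) * v (restrict (~: A) x)].

Definition tensor_qubit (R : realType) (I : finType) (r : I)
    (xi : qubit R) (psi : subregister R [set~ r]) : register R I :=
  [ffun x : {ffun I -> 'I_2} => xi (x r) * psi (restrict [set~ r] x)].

Definition schmidt_decomposition (R : realType) (I : finType)
    (psi : register R I) (A : {set I}) (k : nat) (lambda : 'I_k -> R)
    (u : 'I_k -> subregister R A) (v : 'I_k -> subregister R (~: A)) : Prop :=
  [/\ forall i, 0 <= lambda i,
      orthonormal_family u,
      orthonormal_family v
    & psi = \sum_(i < k) (lambda i)%:C *: tensor (u i) (v i)].

Definition schmidt_coefficient (R : realType) (I : finType)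
    (psi : register R I) (A : {set I}) (l : R) : Prop :=
  exists (k : nat) (lambda : 'I_k -> R)
         (u : 'I_k -> subregister R A) (v : 'I_k -> subregister R (~: A)),
    schmidt_decomposition psi lambda u v /\ exists i, lambda i = l.

(* The nonzero Schmidt coefficients do not depend on the decomposition, so the
   set below is finite and its supremum is a maximum. *)
Definition largest_schmidt (R : realType) (I : finType)
    (psi : register R I) (A : {set I}) : R :=
  sup [set l : R | schmidt_coefficient psi A l]%classic.

(* The parts of a bipartition are A and ~: A.  The default value 0 of the
   maximum is irrelevant when #|I| >= 2, since the terms are nonnegative. *)
Definition GGM (R : realType) (I : finType) (psi : register R I) : R :=
  1 - \big[Num.max/0]_(A : {set I} | (A != finset.set0) && (~: A != finset.set0))
        largest_schmidt psi A ^+ 2.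

(* |xi><xi| on qubit r, tensored with the identity on the other qubits; its
   (x, y) matrix entry is xi(x_r) conj(xi(y_r)) if x and y agree off r,
   and 0 otherwise. *)
Definition measure_op (R : realType) (I : finType) (r : I) (xi : qubit R)
    (Phi : register R I) : register R I :=
  [ffun x : {ffun I -> 'I_2} =>
    \sum_(y : {ffun I -> 'I_2})
      xi (x r) * (xi (y r))^*
        * (restrict [set~ r] x == restrict [set~ r] y)%:R * Phi y].

Definition outcome_prob (R : realType) (I : finType) (r : I) (xi : qubit R)
    (Phi : register R I) : R :=
  complex.Re (braket Phi (measure_op r xi Phi)).

Definition post_measurement (R : realType) (I : finType) (r : I)
    (xi : qubit R) (Phi : register R I) (psi : subregister R [set~ r]) : Prop :=
  unit_ket psi /\
  ((Num.sqrt (outcome_prob r xi Phi))^-1)%:C *: measure_op r xi Phi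
    = tensor_qubit xi psi.

(* An orthonormal family of two vectors of C^2 is an orthonormal basis.  The
   vectors psi l with l of positive probability are determined by xi and
   Phi; the other ones do not contribute to the sum. *)
Definition average_GGM (R : realType) (I : finType) (r : I)
    (Phi : register R I) (s : R) : Prop :=
  exists (xi : 'I_2 -> qubit R) (psi : 'I_2 -> subregister R [set~ r]),
    [/\ orthonormal_family xi,
        forall l, 0 < outcome_prob r (xi l) Phi ->
          post_measurement (xi l) Phi (psi l)
      & s = \sum_(l < 2 | 0 < outcome_prob r (xi l) Phi)
              outcome_prob r (xi l) Phi * GGM (psi l)].

Definition LGGM (R : realType) (I : finType) (r : I) (Phi : register R I) : R :=
  sup [set s : R | average_GGM r Phi s]%classic.

Definition gGHZ (R : realType) (N : nat) (a1 a2 : R[i]) : register R 'I_N :=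
  a1 *: tensor_power 'I_N (basis_ket R 0)
  + a2 *: tensor_power 'I_N (basis_ket R 1).

Definition first_qubit (N : nat) (hN : (3 <= N)%N) : 'I_N :=
  Ordinal (ltnW (ltnW hN)).

(* Main.v *)
(* Across every bipartition the largest Schmidt coefficient of
   a|0...0> + b|1...1> is max(|a|, |b|), so for a unit vector G = min(|a|^2, |b|^2).
   Measuring a qubit in a basis (xi^l) leaves, with the outcome l, an
   unnormalized state of the same form with amplitudes <xi^l|0> a and <xi^l|1> b;
   hence p^l G(psi^l) = min(|xi^l_0 a|^2, |xi^l_1 b|^2).  The sum over l of these
   minima is at most min(|a|^2, |b|^2), because sum_l |xi^l_c|^2 = 1, and the
   Hadamard basis gives equality. *)

Require Import Defs.
From mathcomp Require Import all_boot all_order all_algebra.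
From mathcomp Require Import ring lra.
From mathcomp Require Import complex.
From mathcomp Require Import reals.
From mathcomp Require classical_sets.

Import Order.TTheory GRing.Theory Num.Theory.
Local Open Scope ring_scope.
Local Open Scope complex_scope.

Set Implicit Arguments.
Unset Strict Implicit.
Unset Printing Implicit Defensive.

(* [complex] shadows [restrict]. *)
Import Defs.
Import ComplexField.Normc.

(** * Real-valued moduli of complex numbers *)

Lemma normC_normc (R : realType) (z : R[i]) : `|z| = (normc z)%:C.
Proof. by rewrite normc_def; case: z. Qed.

Lemma conj_mulE (R : realType) (z : R[i]) : z^* * z = (normc z ^+ 2)%:C.
Proof. by rewrite mulrC -normCK normC_normc rmorphXn. Qed.

Lemma normc_ge0 (R : realType) (z : R[i]) : 0 <= normc z.
Proof. by case: z => a b; rewrite sqrtr_ge0. Qed.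

Lemma normc_conj (R : realType) (z : R[i]) : normc (z^*)%R = normc z.
Proof. by apply: complexI; rewrite -!normC_normc norm_conjC. Qed.

Lemma normc_real_ge0 (R : realType) (x : R) : 0 <= x -> normc x%:C = x.
Proof. by move=> x0; rewrite /= expr0n addr0 sqrtr_sqr ger0_norm. Qed.

(** Schmidt coefficients are nonnegative reals, so the phases of the amplitudes have to be split off
    and moved into the Schmidt vectors. For [a = 0] any phase serves. *)
Lemma normc_phase (R : realType) (a : R[i]) :
  exists2 u : R[i], u^* * u = 1 & a = (normc a)%:C * u.
Proof.
have [->|a0] := eqVneq a 0.
  by exists 1; [rewrite rmorph1 mulr1 | rewrite normc0 mul0r].
have n0 : normc a != 0 by apply: contra_neq a0; exact: eq0_normc.
have n0C : (normc a)%:C != 0 :> R[i] by rewrite (inj_eq (@complexI R) _ 0).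
exists (a / (normc a)%:C); last by rewrite mulrCA divff ?mulr1.
rewrite conj_mulE normcM normcV normc_real_ge0 ?normc_ge0 //.
by rewrite divff // expr1n.
Qed.

(** The attained bound supplies both the nonemptiness and the boundedness on which [sup] depends. *)
Lemma sup_max (R : realType) (S : classical_sets.set R) (m : R) :
  S m -> (forall x, S x -> x <= m) -> sup S = m.
Proof.
move=> Sm ubm; apply/le_anti/andP; split.
  by apply: ge_sup; [exists m | exact: ubm].
by apply: ub_le_sup => //; exists m; exact: ubm.
Qed.

Section GHZ.
Variable R : realType.
Implicit Types (I : finType) (a b : R[i]).

(** * States of GHZ form on an arbitrary register *)

Definition const_bits I (c : 'I_2) : {ffun I -> 'I_2} := [ffun=> c].

(** The index type is arbitrary so that the qubits left after a measurement are covered, and the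
    amplitudes are unconstrained so that unnormalized states are too. *)
Definition ghz I a b : register R I :=
  a *: tensor_power I (basis_ket R 0) + b *: tensor_power I (basis_ket R 1).

Lemma tensor_power_basis_ket I (c : 'I_2) (x : {ffun I -> 'I_2}) :
  tensor_power I (basis_ket R c) x = (x == const_bits I c)%:R.
Proof.
rewrite ffunE; have [->|xc] := eqVneq x (const_bits I c).
  by rewrite big1 // => i _; rewrite !ffunE eqxx.
have [i xi] : exists i, x i != c.
  apply/existsP; apply: contraNT xc; rewrite negb_exists => /forallP h.
  by apply/eqP/ffunP => i; rewrite ffunE; apply/eqP; rewrite -[_ == _]negbK.
by rewrite (bigD1 i) //= ffunE (negPf xi) mul0r.
Qed.

Lemma ghzE I a b (x : {ffun I -> 'I_2}) :
  ghz I a b x = a * (x == const_bits I 0)%:R + b * (x == const_bits I 1)%:R.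
Proof. by rewrite !ffunE -!tensor_power_basis_ket !ffunE. Qed.

Lemma const_bits01 I : (0 < #|I|)%N -> const_bits I 0 != const_bits I 1.
Proof.
by case/card_gt0P=> i _; apply/eqP=> /ffunP/(_ i); rewrite !ffunE.
Qed.

Lemma ghz_const I a b : (0 < #|I|)%N ->
  ghz I a b (const_bits I 0) = a /\ ghz I a b (const_bits I 1) = b.
Proof.
move=> I0; rewrite !ghzE !eqxx [const_bits I 1 == _]eq_sym
  (negPf (const_bits01 I0)).
by rewrite !mulr1 !mulr0 addr0 add0r.
Qed.

Lemma sum_delta (T : finType) (f : T -> R[i]) (t : T) :
  \sum_x f x * (x == t)%:R = f t.
Proof.
by rewrite (bigD1 t) //= eqxx mulr1 big1 ?addr0 // => x /negPf->; rewrite mulr0.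
Qed.

Lemma sum_ghz I a b (f : {ffun I -> 'I_2} -> R[i]) :
  \sum_x f x * ghz I a b x = f (const_bits I 0) * a + f (const_bits I 1) * b.
Proof.
rewrite -[in RHS](sum_delta f (const_bits I 0)).
rewrite -[in RHS](sum_delta f (const_bits I 1)) !mulr_suml -big_split /=.
by apply: eq_bigr => x _; rewrite ghzE; ring.
Qed.

Lemma braket_conj (T : finType) (u v : ket R T) :
  ((braket u v)^*)%R = braket v u.
Proof.
rewrite /braket rmorph_sum; apply: eq_bigr => t _.
by rewrite rmorphM /= conjCK mulrC.
Qed.

Lemma braket_ghzl I a b (v : register R I) :
  braket (ghz I a b) v = a^* * v (const_bits I 0) + b^* * v (const_bits I 1).
Proof.
rewrite -braket_conj /braket sum_ghz rmorphD /= !rmorphM /= !conjCK.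
by rewrite ![_ * _^*]mulrC.
Qed.

Lemma braket_ghz I a b : (0 < #|I|)%N ->
  braket (ghz I a b) (ghz I a b) = (normc a ^+ 2 + normc b ^+ 2)%:C.
Proof.
move=> I0; rewrite braket_ghzl.
by have [-> ->] := ghz_const a b I0; rewrite !conj_mulE rmorphD.
Qed.

Lemma ghzZ I (c : R[i]) a b : c *: ghz I a b = ghz I (c * a) (c * b).
Proof. by rewrite scalerDr !scalerA. Qed.

(** * Splitting and gluing bit strings along a bipartition *)

Lemma restrict_const_bits I (A : {set I}) c :
  restrict A (const_bits I c) = const_bits {i | i \in A} c.
Proof. by apply/ffunP=> i; rewrite !ffunE. Qed.

(** Inverse of the pair of restrictions to [A] and [~: A]. Every index lies in one of the two sets,
    so the final default 0 is never reached. *)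
Definition glue I (A : {set I}) (y : {ffun {i | i \in A} -> 'I_2})
    (z : {ffun {i | i \in ~: A} -> 'I_2}) : {ffun I -> 'I_2} :=
  [ffun i => match insub i, insub i with
             | Some j, _ => y j | _, Some j => z j | _, _ => 0 end].

Lemma restrict_glue I (A : {set I}) y z :
  restrict A (glue y z) = y /\ restrict (~: A) (glue y z) = z.
Proof.
split; apply/ffunP=> i; rewrite !ffunE.
  by rewrite valK.
rewrite valK insubN // -in_setC; exact: valP.
Qed.

Lemma restrict_inj I (A : {set I}) (x y : {ffun I -> 'I_2}) :
  restrict A x = restrict A y -> restrict (~: A) x = restrict (~: A) y -> x = y.
Proof.
move=> /ffunP eA /ffunP eC; apply/ffunP=> i; have [iA|iA] := boolP (i \in A).
  by have := eA (exist _ i iA); rewrite !ffunE.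
have iC : i \in ~: A by rewrite in_setC.
by have := eC (exist _ i iC); rewrite !ffunE.
Qed.

Lemma glue_const_bits I (A : {set I}) y z c :
  (glue y z == const_bits I c) =
  (y == const_bits {i | i \in A} c) && (z == const_bits {i | i \in ~: A} c).
Proof.
have [gA gC] := restrict_glue y z.
apply/eqP/andP=> [gc|[/eqP yc /eqP zc]].
  by split; apply/eqP; [rewrite -gA | rewrite -gC]; rewrite gc restrict_const_bits.
apply: (@restrict_inj I A).
  by rewrite gA yc restrict_const_bits.
by rewrite gC zc restrict_const_bits.
Qed.

(** * Upper bound on the Schmidt coefficients *)

Lemma card_sub_gt0 I (A : {set I}) :
  A != finset.set0 -> (0 < #|{: {i | i \in A}}|)%N.
Proof. by rewrite card_sig -card_gt0. Qed.

(* The right-hand side is the inner product of u_i (x) v_i with psi. *)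
Lemma schmidt_coordinate I (psi : register R I) (A : {set I}) k
    (lambda : 'I_k -> R)
    (u : 'I_k -> subregister R A) (v : 'I_k -> subregister R (~: A)) i :
  schmidt_decomposition psi lambda u v ->
  (lambda i)%:C = \sum_y (u i y)^* * (\sum_z (v i z)^* * psi (glue y z)).
Proof.
case=> _ ou ov ->.
(* By orthonormality of both families only the term [j = i] survives. *)
transitivity (\sum_j (lambda j)%:C * braket (u i) (u j) * braket (v i) (v j)).
  rewrite (bigD1 i) //= ou ov eqxx !mulr1 big1 ?addr0 // => j ij.
  by rewrite ou eq_sym (negPf ij) mulr0 mul0r.
transitivity (\sum_j \sum_y (u i y)^* * (\sum_z (v i z)^* *
               ((lambda j)%:C * (u j y * v j z)))).
  apply: eq_bigr => j _; rewrite -mulrA mulrCA /braket mulr_suml.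
  apply: eq_bigr => y _; rewrite !mulr_sumr.
  by apply: eq_bigr => z _; ring.
rewrite exchange_big; apply: eq_bigr => y _.
rewrite -mulr_sumr exchange_big; congr (_ * _); apply: eq_bigr => z _.
rewrite sum_ffunE mulr_sumr; apply: eq_bigr => j _.
by rewrite !ffunE; have [-> ->] := restrict_glue y z.
Qed.

Lemma normc_component_le (T : finType) (u : ket R T) (s t : T) :
  unit_ket u -> s != t -> normc (u s) ^+ 2 + normc (u t) ^+ 2 <= 1.
Proof.
rewrite /unit_ket /braket => uu st.
have: \sum_x normc (u x) ^+ 2 = 1.
  by apply: complexI; rewrite rmorph_sum rmorph1 -uu; apply: eq_bigr => x _;
    rewrite conj_mulE.
move=> <-; rewrite (bigD1 s) //= lerD2l (bigD1 t) /= 1?eq_sym //.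
by rewrite lerDl sumr_ge0 // => x _; rewrite sqr_ge0.
Qed.

(** Pairing the state with [u i] and [v i] sees only their components at the constant strings, so
    the coefficient is at most |u_0||v_0||a| + |u_1||v_1||b|. Since u and v are unit vectors,
    |u_0||v_0| + |u_1||v_1| <= 1. *)
Lemma schmidt_ghz_le I a b (A : {set I}) l :
    A != finset.set0 -> ~: A != finset.set0 ->
  schmidt_coefficient (ghz I a b) A l -> l <= Num.max (normc a) (normc b).
Proof.
move=> A0 C0 [k [lambda [u [v [dec [i <-]]]]]].
have := schmidt_coordinate i dec; case: dec => l0 ou ov _.
set yb := const_bits {i | i \in A}; set zb := const_bits {i | i \in ~: A}.
have -> : \sum_y (u i y)^* * (\sum_z (v i z)^* * ghz I a b (glue y z)) =
          (u i (yb 0))^* * (v i (zb 0))^* * a +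
          (u i (yb 1))^* * (v i (zb 1))^* * b.
  (* The partial inner product with [v i] is again of GHZ form on the qubits of [A]. *)
  under eq_bigr => y _.
    have -> : \sum_z (v i z)^* * ghz I a b (glue y z) =
      ghz _ ((v i (zb 0))^* * a) ((v i (zb 1))^* * b) y.
      rewrite ghzE -/yb -(sum_delta (fun z => ((v i z)^*)%R) (zb 0)).
      rewrite -(sum_delta (fun z => ((v i z)^*)%R) (zb 1)) !mulr_suml -big_split /=.
      apply: eq_bigr => z _; rewrite ghzE !glue_const_bits -/yb -/zb.
      by do 4!case: (_ == _); rewrite /=; ring.
    over.
  by rewrite sum_ghz !mulrA.
move=> lE; have {lE}: lambda i <=
   normc (u i (yb 0)) * normc (v i (zb 0)) * normc a
   + normc (u i (yb 1)) * normc (v i (zb 1)) * normc b.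
  rewrite -(normc_real_ge0 (l0 i)) lE.
  by apply: le_trans (le_normcD _ _) _; rewrite !normcM !normc_conj.
have u1 : unit_ket (u i) by rewrite /unit_ket ou eqxx.
have v1 : unit_ket (v i) by rewrite /unit_ket ov eqxx.
have := normc_component_le u1 (const_bits01 (card_sub_gt0 A0)).
have := normc_component_le v1 (const_bits01 (card_sub_gt0 C0)).
rewrite -/(yb 0) -/(yb 1) -/(zb 0) -/(zb 1).
have := normc_ge0 (u i (yb 0)); have := normc_ge0 (u i (yb 1)).
have := normc_ge0 (v i (zb 0)); have := normc_ge0 (v i (zb 1)).
have: normc a <= Num.max (normc a) (normc b) by rewrite le_max lexx.
have: normc b <= Num.max (normc a) (normc b) by rewrite le_max lexx orbT.
have := normc_ge0 a.
move: (normc a) (normc b) (normc (u _ _)) (normc (u _ _))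
  (normc (v _ _)) (normc (v _ _)) (Num.max _ _) => x y p q r s m x0 ym xm s0 r0 q0 p0 hv hu /le_trans; apply.
have m0 := le_trans x0 xm.
apply: (@le_trans _ _ (m * (p * r + q * s))).
  have := ler_wpM2l (mulr_ge0 p0 r0) xm; have := ler_wpM2l (mulr_ge0 q0 s0) ym.
  lra.
rewrite -[leRHS]mulr1 ler_wpM2l //.
(* Here 2pr <= p^2 + r^2 and 2qs <= q^2 + s^2, while p^2 + q^2 and r^2 + s^2 are at most 1. *)
have := sqr_ge0 (p - r); have := sqr_ge0 (q - s); lra.
Qed.

(** * A Schmidt decomposition that attains the bound *)

Lemma tensorZ I (A : {set I}) (c d : R[i]) (u : subregister R A)
    (v : subregister R (~: A)) :
  tensor (c *: u) (d *: v) = (c * d) *: tensor u v.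
Proof. by apply/ffunP=> x; rewrite !ffunE /GRing.scale /=; ring. Qed.

Lemma tensor_basis I (A : {set I}) c :
  @tensor R I A (tensor_power _ (basis_ket R c)) (tensor_power _ (basis_ket R c))
  = tensor_power I (basis_ket R c).
Proof.
apply/ffunP=> x; rewrite [LHS]ffunE !tensor_power_basis_ket -natrM mulnb.
congr (nat_of_bool _)%:R; apply/andP/eqP => [[/eqP xA /eqP xC]|->].
  by apply: (@restrict_inj I A); rewrite ?xA ?xC restrict_const_bits.
by rewrite !restrict_const_bits !eqxx.
Qed.

Lemma braketZ (T : finType) (c d : R[i]) (u v : ket R T) :
  braket (c *: u) (d *: v) = c^* * d * braket u v.
Proof.
rewrite /braket mulr_sumr; apply: eq_bigr => t _.
by rewrite !ffunE rmorphM /GRing.scale /=; ring.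
Qed.

Lemma orthonormal_ghz I (w : 'I_2 -> R[i]) : (0 < #|I|)%N ->
    (forall c, (w c)^* * w c = 1) ->
  orthonormal_family (fun c => w c *: tensor_power I (basis_ket R c)).
Proof.
move=> I0 w1 j k; rewrite braketZ /braket.
under eq_bigr do rewrite (tensor_power_basis_ket k).
rewrite sum_delta tensor_power_basis_ket.
have -> : (const_bits I k == const_bits I j) = (j == k).
  apply/eqP/eqP => [|->//]; case/card_gt0P: I0 => i _.
  by move=> /ffunP/(_ i); rewrite !ffunE.
by have [->|_] := eqVneq j k; rewrite /= ?w1 ?conjC1 ?mulr1 // conjC0 mulr0.
Qed.

(** The defining expression of the state is already a Schmidt decomposition, once the phases of a
    and b are absorbed into the vectors on the [A] side. Two terms are kept even if an amplitude
    vanishes, as zero coefficients are allowed. *)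
Lemma schmidt_ghz I a b (A : {set I}) :
    A != finset.set0 -> ~: A != finset.set0 ->
  schmidt_coefficient (ghz I a b) A (Num.max (normc a) (normc b)).
Proof.
move=> A0 C0.
have [wa wa1 aE] := normc_phase a; have [wb wb1 bE] := normc_phase b.
pose w (c : 'I_2) := if c == 0 then wa else wb.
pose l (c : 'I_2) := normc (if c == 0 then a else b).
exists 2, l, (fun c => w c *: tensor_power _ (basis_ket R c)),
  (fun c => 1 *: tensor_power _ (basis_ket R c)); split.
  split.
  - by move=> i; exact: normc_ge0.
  - by apply: orthonormal_ghz => [|c]; [exact: card_sub_gt0 | rewrite /w; case: ifP].
  - by apply: orthonormal_ghz => [|c]; [exact: card_sub_gt0 | rewrite conjC1 mulr1].
  - rewrite big_ord_recl big_ord1 !tensorZ !tensor_basis !scalerA !mulr1.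
    by rewrite /l /w /= -aE -bE.
have [ab|ab] := leP (normc a) (normc b); first by exists 1.
by exists 0.
Qed.

(** * The generalized geometric measure *)

Lemma largest_schmidt_ghz I a b (A : {set I}) :
    A != finset.set0 -> ~: A != finset.set0 ->
  largest_schmidt (ghz I a b) A = Num.max (normc a) (normc b).
Proof.
move=> A0 C0; apply: sup_max; first exact: schmidt_ghz.
by move=> x; exact: schmidt_ghz_le.
Qed.

Lemma GGM_ghz I a b : (1 < #|I|)%N ->
  GGM (ghz I a b) = 1 - Num.max (normc a) (normc b) ^+ 2.
Proof.
move=> I1; congr (1 - _).
rewrite (eq_bigr (fun=> Num.max (normc a) (normc b) ^+ 2)); last first.
  by move=> A /andP[A0 C0]; rewrite largest_schmidt_ghz.
have [x _] : exists x : I, x \in I by apply/card_gt0P; exact: ltnW.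
apply/le_anti/andP; split.
  by apply: bigmax_le => //; exact: sqr_ge0.
(* All terms of the maximum are equal, so one bipartition suffices: a single qubit against the rest,
   which is nonempty as there are at least two qubits. *)
apply: (bigmax_sup [set x]) => //.
by rewrite -!card_gt0 cards1 cardsC1 -subn1 subn_gt0 I1.
Qed.

Lemma max_sqr (x y : R) : 0 <= x -> 0 <= y ->
  Num.max x y ^+ 2 = Num.max (x ^+ 2) (y ^+ 2).
Proof.
move=> x0 y0; have [xy|xy] := leP x y.
  by apply/esym/max_idPr; rewrite ler_sqr.
by apply/esym/max_idPl; rewrite ler_sqr // ltW.
Qed.

(** With c = 1/sqrt p the product is p - max(|a|^2, |b|^2), and p is the sum of the two squares, so
    their minimum remains. *)
Lemma scaled_GGM_ghz I a b (c p : R) : (1 < #|I|)%N -> 0 <= c ->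
    c ^+ 2 * p = 1 -> p = normc a ^+ 2 + normc b ^+ 2 ->
  p * GGM (c%:C *: ghz I a b) = Num.min (normc a ^+ 2) (normc b ^+ 2).
Proof.
move=> I1 c0 cp pE; rewrite ghzZ GGM_ghz // !normcM !normc_real_ge0 //.
rewrite -maxr_pMr // exprMn mulrBr mulr1 mulrA [p * _]mulrC cp mul1r.
rewrite max_sqr ?normc_ge0 // pE.
by rewrite -[normc a ^+ 2 + _]addr_max_min addrC addKr.
Qed.

Lemma GGM_unit_ghz I a b : (1 < #|I|)%N -> normc a ^+ 2 + normc b ^+ 2 = 1 ->
  GGM (ghz I a b) = Num.min (normc a ^+ 2) (normc b ^+ 2).
Proof.
move=> I1 ab; rewrite -(@scaled_GGM_ghz I a b 1 1) // ?ab ?expr1n ?mulr1 //.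
by rewrite mul1r rmorph1 scale1r.
Qed.

(** * Measuring one qubit *)

Lemma measure_op_ghz I (r : I) (xi : qubit R) a b :
  measure_op r xi (ghz I a b) =
  @tensor_qubit R I r xi (ghz _ ((xi 0)^* * a) ((xi 1)^* * b)).
Proof.
apply/ffunP=> x; rewrite [LHS]ffunE [RHS]ffunE.
under eq_bigr => y _ do rewrite -!mulrA.
rewrite -mulr_sumr; congr (_ * _).
under eq_bigr => y _ do rewrite mulrA.
rewrite sum_ghz ghzE !restrict_const_bits !ffunE.
by ring.
Qed.

Lemma outcome_prob_ghz I (r : I) (xi : qubit R) a b : (1 < #|I|)%N ->
  outcome_prob r xi (ghz I a b) =
  normc ((xi 0)^* * a) ^+ 2 + normc ((xi 1)^* * b) ^+ 2.
Proof.
move=> I1; rewrite /outcome_prob measure_op_ghz braket_ghzl.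
set psi := ghz _ _ _.
have [psi0 psi1] : psi (const_bits _ 0) = (xi 0)^* * a /\
                   psi (const_bits _ 1) = (xi 1)^* * b.
  by apply: ghz_const; apply: card_sub_gt0; rewrite -card_gt0 cardsC1 -subn1 subn_gt0.
have H (x z : R[i]) : z^* * (x * (x^* * z)) = (normc (x^* * z) ^+ 2)%:C.
  by rewrite -conj_mulE rmorphM /= conjCK; ring.
have tE c : tensor_qubit xi psi (const_bits I c) = xi c * psi (const_bits _ c).
  by rewrite [LHS]ffunE restrict_const_bits ffunE.
by rewrite !tE psi0 psi1 !H -rmorphD.
Qed.

Lemma tensor_qubitZ I (r : I) (xi : qubit R) (c : R[i]) psi :
  c *: @tensor_qubit R I r xi psi = tensor_qubit xi (c *: psi).
Proof. by apply/ffunP=> x; rewrite !ffunE /GRing.scale /=; ring. Qed.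

(** A unit qubit has a nonzero component, which can be cancelled; this makes the state after the
    measurement unique. *)
Lemma tensor_qubit_inj I (r : I) (xi : qubit R) :
  unit_ket xi -> injective (@tensor_qubit R I r xi).
Proof.
move=> xi1 psi psi' e.
have [c xic] : exists c, xi c != 0.
  apply/existsP; apply: contraPT xi1; rewrite negb_exists => /forallP h.
  rewrite /unit_ket /braket big1 => [|c _]; first by move/esym/eqP; rewrite oner_eq0.
  by have := h c; rewrite negbK => /eqP->; rewrite mulr0.
(* [x] extends [z] by the bit [c] at [r], the only index where [insub] fails. *)
apply/ffunP=> z; pose x : {ffun I -> 'I_2} := [ffun i => oapp z c (insub i)].
have xr : x r = c by rewrite ffunE insubN // !inE eqxx.
have xz : restrict [set~ r] x = z by apply/ffunP=> i; rewrite !ffunE valK.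
have := congr1 (fun Phi : register R I => Phi x) e.
by rewrite ![tensor_qubit _ _ x]ffunE xr xz; exact: mulfI.
Qed.

Lemma post_measurement_ghz I (r : I) (xi : qubit R) a b : (1 < #|I|)%N ->
  unit_ket xi -> 0 < outcome_prob r xi (ghz I a b) ->
  forall psi : subregister R [set~ r], post_measurement xi (ghz I a b) psi <->
    psi = ((Num.sqrt (outcome_prob r xi (ghz I a b)))^-1)%:C
            *: ghz _ ((xi 0)^* * a) ((xi 1)^* * b).
Proof.
move=> I1 xi1 p0 psi; rewrite /post_measurement measure_op_ghz tensor_qubitZ.
split=> [[_ /(tensor_qubit_inj xi1)//]|->]; split=> //.
rewrite /unit_ket braketZ braket_ghz; last first.
  by apply: card_sub_gt0; rewrite -card_gt0 cardsC1 -subn1 subn_gt0.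
rewrite -(@outcome_prob_ghz I r) // conj_mulE normc_real_ge0 ?invr_ge0 ?sqrtr_ge0 //.
by rewrite -rmorphM exprVn sqr_sqrtr ?(ltW p0) // mulVf ?gt_eqF.
Qed.

(** Three qubits guarantee that at least two remain, so the remaining register has a bipartition.
    The formula also holds for outcomes of probability zero, which frees the sum over outcomes from
    its side condition. *)
Lemma outcome_GGM_ghz I (r : I) (xi : qubit R) (psi : subregister R [set~ r])
    a b : (2 < #|I|)%N ->
    unit_ket xi ->
    (0 < outcome_prob r xi (ghz I a b) -> post_measurement xi (ghz I a b) psi) ->
  (if 0 < outcome_prob r xi (ghz I a b)
   then outcome_prob r xi (ghz I a b) * GGM psi else 0) =
  Num.min (normc ((xi 0)^* * a) ^+ 2) (normc ((xi 1)^* * b) ^+ 2).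
Proof.
move=> I2 xi1; have I1 := ltnW I2; case: ltP => [p0 /(_ isT)|p0 _].
  move=> /(post_measurement_ghz I1 xi1 p0)->; apply: scaled_GGM_ghz.
  - by rewrite card_sig -[X in (_ < X)%N]/#|_| cardsC1 -subn1 ltn_subRL.
  - by rewrite invr_ge0 sqrtr_ge0.
  - by rewrite exprVn sqr_sqrtr ?(ltW p0) // mulVf ?gt_eqF.
  - exact: outcome_prob_ghz.
(* The probability is a sum of two squares; if it is not positive, both vanish and so does their
   minimum. *)
move: p0; rewrite outcome_prob_ghz //.
have := sqr_ge0 (normc ((xi 0)^* * a)); have := sqr_ge0 (normc ((xi 1)^* * b)).
by move=> y0 x0 xy; apply/le_anti; rewrite le_min x0 y0 ge_min; lra.
Qed.

(** * Orthonormal bases of one qubit *)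

(** A one-sided inverse of a square matrix is two-sided, so orthonormal rows force orthonormal
    columns; the claim is a diagonal entry. *)
Lemma orthonormal_completeness (xi : 'I_2 -> qubit R) (c : 'I_2) :
  orthonormal_family xi -> \sum_l normc (xi l c) ^+ 2 = 1.
Proof.
move=> o; pose U : 'M[R[i]]_2 := \matrix_(l, c) xi l c.
have /mulmx1C/matrixP/(_ c c) : (\matrix_(l, c) (xi l c)^*) *m U^T = 1%:M.
  apply/matrixP=> j k; rewrite !mxE -o /braket.
  by apply: eq_bigr => t _; rewrite !mxE.
rewrite !mxE eqxx => e; apply: complexI; rewrite rmorph_sum rmorph1 -[RHS]e.
by apply: eq_bigr => l _; rewrite !mxE mulrC conj_mulE.
Qed.

Definition hadamard_basis (l : 'I_2) : qubit R :=
  [ffun c : 'I_2 => ((Num.sqrt 2)^-1)%:C * (-1) ^+ (l * c)].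

Lemma invsqrt2_sqr : ((Num.sqrt 2)^-1 : R) ^+ 2 = 2^-1.
Proof. by rewrite exprVn sqr_sqrtr. Qed.

Lemma normc_hadamard_basis l c : normc (hadamard_basis l c) ^+ 2 = 2^-1.
Proof.
rewrite ffunE normcM exprMn normc_real_ge0 ?invr_ge0 ?sqrtr_ge0 //.
rewrite invsqrt2_sqr; suff -> : normc ((-1) ^+ (l * c) : R[i]) = 1 by ring.
by apply: complexI; rewrite -normC_normc normrX normrN1 expr1n.
Qed.

Lemma orthonormal_hadamard_basis : orthonormal_family hadamard_basis.
Proof.
move=> j k; rewrite /braket big_ord_recl big_ord1 !ffunE.
set s : R[i] := _%:C.
have ss : s^* * s = 2^-1.
  by rewrite conj_mulE normc_real_ge0 ?invr_ge0 ?sqrtr_ge0 // invsqrt2_sqr fmorphV rmorph_nat.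
rewrite !rmorphM /= !rmorphXn /= !rmorphN /= !rmorph1.
have E x y z t : s^* * x * (s * y) + s^* * z * (s * t) = 2^-1 * (x * y + z * t).
  by rewrite -ss; ring.
rewrite E; have two_neq0 : 2 != 0 :> R[i] by rewrite pnatr_eq0.
by case: j k => [[|[|//]] jl] [[|[|//]] kl] /=; rewrite ?expr0 ?expr1; field.
Qed.

(** * The average over outcomes and its supremum *)

Lemma GGM_average_ghz I (r : I) (xi : 'I_2 -> qubit R)
    (psi : 'I_2 -> subregister R [set~ r]) a b : (2 < #|I|)%N ->
    orthonormal_family xi ->
    (forall l, 0 < outcome_prob r (xi l) (ghz I a b) ->
       post_measurement (xi l) (ghz I a b) (psi l)) ->
  \sum_(l < 2 | 0 < outcome_prob r (xi l) (ghz I a b))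
     outcome_prob r (xi l) (ghz I a b) * GGM (psi l) =
  \sum_l Num.min (normc (xi l 0) ^+ 2 * normc a ^+ 2)
                 (normc (xi l 1) ^+ 2 * normc b ^+ 2).
Proof.
move=> I2 o post; rewrite big_mkcond; apply: eq_bigr => l _.
have xi1 : unit_ket (xi l) by rewrite /unit_ket o eqxx.
by rewrite (outcome_GGM_ghz I2 xi1 (post l)) !normcM !normc_conj !exprMn.
Qed.

Lemma LGGM_ghz I (r : I) a b : (2 < #|I|)%N ->
  LGGM r (ghz I a b) = Num.min (normc a ^+ 2) (normc b ^+ 2).
Proof.
move=> I2; apply: sup_max => [|s [xi [psi [o post ->]]]].
  (* Attainment: all squared moduli in the Hadamard basis are 1/2, so each of the two outcomes
     contributes half of the minimum. *)
  have o := orthonormal_hadamard_basis.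
  pose psi l : subregister R [set~ r] :=
    ((Num.sqrt (outcome_prob r (hadamard_basis l) (ghz I a b)))^-1)%:C
      *: ghz _ ((hadamard_basis l 0)^* * a) ((hadamard_basis l 1)^* * b).
  have post l : 0 < outcome_prob r (hadamard_basis l) (ghz I a b) ->
    post_measurement (hadamard_basis l) (ghz I a b) (psi l).
    move=> p0; apply/post_measurement_ghz => //; first exact: ltnW.
    by rewrite /unit_ket o eqxx.
  exists hadamard_basis, psi; split=> //.
  rewrite GGM_average_ghz // big_ord_recl big_ord1.
  rewrite !normc_hadamard_basis -!minr_pMr ?invr_ge0 //.
  by field.
rewrite GGM_average_ghz //.
have := orthonormal_completeness 0 o; have := orthonormal_completeness 1 o.
rewrite !big_ord_recl !big_ord0 !addr0 => c1 c0.
(* Each minimum is bounded by its first argument, then by its second; completeness at the bit 0,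
   respectively 1, sums the weights to 1. *)
rewrite le_min; apply/andP; split.
  by rewrite -[leRHS]mul1r -c0 mulrDl lerD // ge_min lexx.
by rewrite -[leRHS]mul1r -c1 mulrDl lerD // ge_min lexx orbT.
Qed.

End GHZ.

Theorem proposition1 (R : realType) (N : nat) (hN : (3 <= N)%N)
    (a1 a2 : R[i]) (ha : `|a1| ^+ 2 + `|a2| ^+ 2 = 1) :
  LGGM (first_qubit hN) (gGHZ N a1 a2) = GGM (gGHZ N a1 a2).
Proof.
have a1a2 : normc a1 ^+ 2 + normc a2 ^+ 2 = 1.
  by apply: complexI; rewrite rmorph1 -ha !normC_normc -!rmorphXn -rmorphD.
(* [gGHZ] is convertible to [ghz] over ['I_N]; both sides then equal the smaller squared
   amplitude. *)
rewrite -[gGHZ N a1 a2]/(ghz 'I_N a1 a2) LGGM_ghz ?card_ord //.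
by rewrite GGM_unit_ghz // card_ord; exact: ltnW.
Qed.
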